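(* Let $d\ge 1$, let $\lambda_1,\dots,\lambda_d>0$ with $\sum_{i=1}^d\lambda_i=1$, and let $|\psi\rangle=\sum_{i=1}^d\sqrt{\lambda_i}\,|i\rangle\in\mathbb{C}^d$. Then $$C_{\mathrm{tr}}(|\psi\rangle)=2\min_{\delta_i\ge 0,\ \sum_i\delta_i=1}\ \max\Big\{x\ge 0:\ \sum_{i=1}^d\frac{\lambda_i}{x+\delta_i}=1\Big\},$$ (where the equation is understood to require $x+\delta_i>0$ for all $i$). Moreover, this equals the optimal value of the following optimization problem in the variables $\delta_1,\dots,\delta_d$: $$\text{minimize}\quad \frac{2}{d}\Big(\sum_{i=1}^d\frac{\lambda_i}{\delta_i}-1\Big)$$ subject to $\dfrac{\lambda_i}{\delta_i}\ge\dfrac1d\Big(\sum_{j=1}^d\dfrac{\lambda_j}{\delta_j}-1\Big)$ for all $i=1,\dots,d$, $\ \sum_{i=1}^d\delta_i\le 1$, and $\delta_i> 0$ for all $i$.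
   Context: $\{|i\rangle\}_{i=1}^d$ is the fixed standard basis of $\mathbb{C}^d$. A state is a positive semidefinite $d\times d$ complex matrix of trace $1$; an incoherent state is a diagonal state, and $\mathcal{I}$ is the set of incoherent states. $\|X\|_1=\mathrm{Tr}\sqrt{X^\dagger X}$ is the trace norm. The trace distance coherence of a state $\rho$ is $C_{\mathrm{tr}}(\rho):=\min_{\delta\in\mathcal{I}}\|\rho-\delta\|_1$, and $C_{\mathrm{tr}}(|\psi\rangle):=C_{\mathrm{tr}}(|\psi\rangle\langle\psi|)$. *)

(* Defs.v *)
From mathcomp Require Import all_boot all_order all_algebra.
From mathcomp Require Import boolp classical_sets reals constructive_ereal ereal.
From mathcomp Require Import complex.

Set Implicit Arguments.
Unset Strict Implicit.
Unset Printing Implicit Defensive.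

Import Order.TTheory GRing.Theory Num.Theory.
Local Open Scope classical_set_scope.
Local Open Scope ring_scope.
Local Open Scope complex_scope.
Local Open Scope sesquilinear_scope.

Section Extrema.
Context {R : realType}.
Implicit Types S : set R.

Definition is_min S (m : R) := S m /\ lbound S m.
Definition is_max S (m : R) := S m /\ ubound S m.

Definition has_min S := exists m, is_min S m.
Definition has_max S := exists m, is_max S m.

(* These are the attained extrema; the default value 0 is taken only when there
   is none, i.e., when has_min S (resp. has_max S) fails. *)
Definition minimum S : R := xget 0 [set m | is_min S m].
Definition maximum S : R := xget 0 [set m | is_max S m].

End Extrema.

Section States.
Context {R : realType} {d : nat}.
Implicit Types A X rho : 'M[R[i]]_d.

(* The order of R[i] is such that 0 <= z forces z to be real, so this condition
   implies that A is Hermitian. *)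
Definition psdmx A := forall v : 'cV[R[i]]_d, 0 <= (v^t* *m A *m v) 0 0.

Definition is_state A := psdmx A /\ \tr A = 1.

Definition incoherent : set 'M[R[i]]_d :=
  [set A | is_state A /\ is_diag_mx A].

(* The positive semidefinite square root of a positive semidefinite A, obtained
   by taking square roots of the eigenvalues in a unitary diagonalization of A
   (orthomx_spectralP); it is only meaningful for such A. *)
Definition sqrtmx A : 'M[R[i]]_d :=
  invmx (spectralmx A) *m diag_mx (map_mx sqrtC (spectral_diag A))
    *m spectralmx A.

(* The trace is a nonnegative real element of R[i]; Re only casts it to R. *)
Definition trnorm X : R := complex.Re (\tr (sqrtmx (X^t* *m X))).

Definition trdists rho : set R :=
  [set trnorm (rho - delta) | delta in incoherent].

Definition Ctr rho : R := minimum (trdists rho).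

Definition projector (psi : 'cV[R[i]]_d) : 'M[R[i]]_d := psi *m psi^t*.

Definition sqrt_ket (lambda : 'I_d -> R) : 'cV[R[i]]_d :=
  \col_i (Num.sqrt (lambda i))%:C.

End States.

Section Optimization.
Context {R : realType} {d : nat}.
Implicit Types lambda delta : 'I_d -> R.

Definition simplex : set ('I_d -> R) :=
  [set delta | (forall i, 0 <= delta i) /\ \sum_i delta i = 1].

Definition secular_roots lambda delta : set R :=
  [set x | [/\ 0 <= x, forall i, 0 < x + delta i
             & \sum_i lambda i / (x + delta i) = 1]].

Definition secular_maxima lambda : set R :=
  [set maximum (secular_roots lambda delta) | delta in simplex].

Definition objective lambda delta : R :=
  2 / d%:R * (\sum_i lambda i / delta i - 1).

Definition feasible lambda : set ('I_d -> R) :=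
  [set delta | [/\ forall i, d%:R^-1 * (\sum_j lambda j / delta j - 1)
                             <= lambda i / delta i,
                   \sum_i delta i <= 1
                 & forall i, 0 < delta i]].

(* The infimum is taken in \bar R, so that it is +oo for an infeasible problem
   and -oo for an unbounded one. *)
Definition optimal_value lambda : \bar R :=
  ereal_inf [set (objective lambda delta)%:E | delta in feasible lambda].

End Optimization.

(* Main.v *)
(* For delta in the simplex and D = diag delta, a nonnegative root x of the
   secular equation is an eigenvalue of X = |psi><psi| - D, with eigenvector
   v i = sqrt (lambda i) / (x + delta i).  Since D v = psi - x v and <psi, v> = 1,
   the matrix 2 x |v><v| / |v|^2 - X equals
     (1 - |v><psi|)^* D (1 - |v><psi|)
       + x / |v|^2 (|v><v| + |v - |v|^2 psi><v - |v|^2 psi|),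
   so it is positive semidefinite; its square is X^2, hence it is |X|, and
   ||X||_1 = 2 x because X is traceless.  Thus the trace distances are the numbers
   2 x.  With y i = x + delta i, minimizing x becomes the convex problem
   x <= y i, \sum_i lambda i / y i <= 1, \sum_i (y i - x) <= 1, which the
   substitution delta i = lambda i / y i turns into the second program.  It is
   solved explicitly by y i = mu * max s (sqrt (lambda i)), x = mu * s, and
   weak duality proves optimality. *)
Require Import Defs.
From mathcomp Require Import all_boot all_order all_algebra.
From mathcomp Require Import boolp classical_sets reals constructive_ereal ereal.
From mathcomp Require Import complex.
From mathcomp Require Import ring lra.
From mathcomp Require Import topology normedtype.

Set Implicit Arguments.
Unset Strict Implicit.
Unset Printing Implicit Defensive.

Import Order.TTheory GRing.Theory Num.Theory.
Import numFieldNormedType.Exports.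
Local Open Scope classical_set_scope.
Local Open Scope complex_scope.
Local Open Scope ring_scope.

(** * Attained extrema of sets of reals *)

Section Extrema.
Context {R : realType}.
Implicit Types S : set R.

Lemma minimumE S m : is_min S m -> minimum S = m.
Proof.
move=> mP; apply: xget_unique => // y [Sy yS].
by apply/le_anti/andP; split; [apply: yS; case: mP | case: mP => _; apply].
Qed.

Lemma maximumE S m : is_max S m -> maximum S = m.
Proof.
move=> mP; apply: xget_unique => // y [Sy yS].
by apply/le_anti/andP; split; [case: mP => _; apply | apply: yS; case: mP].
Qed.

Lemma is_min_scale (k : R) S m : 0 <= k ->
  is_min S m -> is_min [set k * x | x in S] (k * m).
Proof.
move=> k0 [Sm mS]; split; first by exists m.
by move=> _ [x Sx <-]; rewrite ler_wpM2l// mS.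
Qed.

End Extrema.

(** * The secular equation and the convex program behind both minimizations *)

Section SecularEquation.
Context {R : realType} {d : nat}.
Variable lambda : 'I_d -> R.
Hypothesis lambda_gt0 : forall i, 0 < lambda i.
Hypothesis lambda_sum : \sum_i lambda i = 1.
Implicit Types delta : 'I_d -> R.

Lemma lambda_le1 i : lambda i <= 1.
Proof.
rewrite -lambda_sum (bigD1 i)//= lerDl sumr_ge0// => j _; exact: ltW.
Qed.

Lemma sqrt_lambda_le1 i : Num.sqrt (lambda i) <= 1.
Proof. by rewrite -sqrtr1 ler_wsqrtr// lambda_le1. Qed.

Lemma index_inhabited : exists i : 'I_d, true.
Proof.
apply/existsP; apply: contra_eqT lambda_sum => /existsPn no_i.
by rewrite big1 1?eq_sym ?oner_neq0// => i _; have := no_i i.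
Qed.

Lemma simplex_le1 delta i : simplex delta -> delta i <= 1.
Proof. by case=> delta0 <-; rewrite (bigD1 i)//= lerDl sumr_ge0. Qed.

Lemma has_index : has (fun _ : 'I_d => true) (index_enum 'I_d).
Proof.
have [i _] := index_inhabited.
by apply/hasP; exists i; rewrite ?mem_index_enum.
Qed.

(** The sum is strictly decreasing in [x] as long as all denominators are positive. So the maximum
    over the roots is the root itself. *)
Lemma secular_roots_unique delta x y :
  secular_roots lambda delta x -> secular_roots lambda delta y -> x = y.
Proof.
wlog xy : x y / x < y.
  by case: (ltgtP x y) => // xy H rx ry; [|symmetry]; exact: H.
move=> [x0 xpos xE] [y0 ypos yE].
suff : \sum_i lambda i / (y + delta i) < \sum_i lambda i / (x + delta i).
  by rewrite xE yE ltxx.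
apply: ltr_sum; first exact: has_index.
by move=> i _; rewrite ltr_pM2l// ltf_pV2 ?posrE ?ltrD2r.
Qed.

Lemma secular_continuous delta x : (forall i, 0 < x + delta i) ->
  {for x, continuous (fun x => \sum_i lambda i / (x + delta i))}.
Proof.
move=> pos; apply: cvg_big => [|i _]; first exact: add_continuous; apply: cvgM; first exact: cvg_cst.
apply: cvgV; first by rewrite gt_eqF.
by apply: cvgD; [exact: cvg_id | exact: cvg_cst].
Qed.

(** At 1 every denominator is at least 1, so the sum is at most [\sum_i lambda i = 1]; the
    intermediate value theorem applies on [[a, 1]]. *)
Lemma secular_ivt delta a : 0 <= a <= 1 -> (forall i, 0 <= delta i) ->
  (forall i, 0 < a + delta i) -> 1 <= \sum_i lambda i / (a + delta i) ->
  exists x, secular_roots lambda delta x.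
Proof.
move=> /andP[a0 a1] delta0 apos fa.
have pos x : a <= x -> forall i, 0 < x + delta i.
  by move=> ax i; rewrite (lt_le_trans (apos i))// lerD2r.
have f1 : \sum_i lambda i / (1 + delta i) <= 1.
  rewrite -[leRHS]lambda_sum; apply: ler_sum => i _.
  by rewrite ler_pdivrMr ?pos// ler_peMr ?lerDl ?(ltW (lambda_gt0 i)).
have [||x] := @IVT R (fun x => \sum_i lambda i / (x + delta i)) a 1 1 a1.
- apply: continuous_in_subspaceT => x; rewrite inE/= in_itv/= => /andP[ax _].
  exact: secular_continuous (pos _ ax).
- by rewrite ge_min f1 orbT le_max fa.
rewrite in_itv/= => /andP[ax _] xE; exists x; split => //.
- exact: le_trans ax.
- exact: pos.
Qed.

Lemma secular_roots_exists delta : simplex delta ->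
  exists x, secular_roots lambda delta x.
Proof.
move=> sdelta; have [delta0 _] := sdelta.
have [/existsP[i /eqP di0]|/existsPn dn0] := boolP [exists i, delta i == 0].
  have pos j : 0 < lambda i + delta j by rewrite ltr_wpDr.
  (* Since [delta i = 0], the left endpoint cannot be 0; at [lambda i] the [i]-th term alone is
     already 1. *)
  apply: (@secular_ivt _ (lambda i)) => //; first by rewrite ltW// lambda_le1.
  rewrite (bigD1 i)//= di0 addr0 divff ?gt_eqF// lerDl sumr_ge0// => j _.
  by rewrite divr_ge0// ltW.
have pos j : 0 < delta j by rewrite lt_neqAle eq_sym dn0 delta0.
apply: (@secular_ivt _ 0) => //; first by rewrite lexx ler01.
  by move=> i; rewrite add0r.
rewrite -[X in X <= _]lambda_sum; apply: ler_sum => i _; rewrite add0r.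
by rewrite ler_pdivlMr// ler_piMr ?simplex_le1 ?(ltW (lambda_gt0 i)).
Qed.

Lemma secular_roots_max delta x :
  secular_roots lambda delta x -> is_max (secular_roots lambda delta) x.
Proof. by move=> rx; split=> // y ry; rewrite (secular_roots_unique ry rx). Qed.

(* Weak duality, with [k * (1 - c i)] as Lagrange multiplier of the constraint
   [x' <= y' i]; convexity enters through the tangents of [t |-> lambda i / t]. *)
Lemma waterfilling_le (y c y' : 'I_d -> R) (k x x' : R) :
  0 < k -> (forall i, 0 < y i) -> (forall i, 0 < c i <= 1) ->
  (forall i, lambda i = k * c i * y i ^+ 2) ->
  (forall i, c i * (y i - x) = y i - x) ->
  \sum_i lambda i / y i = 1 -> \sum_i (y i - x) = 1 ->
  (forall i, 0 < y' i) -> (forall i, x' <= y' i) ->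
  \sum_i lambda i / y' i <= 1 -> \sum_i (y' i - x') <= 1 ->
  x <= x'.
Proof.
move=> k0 y0 c01 lamE cy sumy1 sumyx y'0 x'y' sumy'1 sumy'x'.
(* The slope at [y i] is [- lambda i / y i ^+ 2 = - k * c i], and the gap is
   [k * c i * (y' i - y i) ^+ 2 / y' i]. *)
have tangent i : lambda i / y i - k * c i * (y' i - y i) <= lambda i / y' i.
  have /andP[ci _] := c01 i.
  have yy := y0 i; have yy' := y'0 i.
  rewrite ler_pdivlMr// lamE.
  have -> : k * c i * y i ^+ 2 / y i = k * c i * y i.
    by field; rewrite gt_eqF.
  have kc := mulr_gt0 k0 ci.
  have := mulr_ge0 (ltW kc) (sqr_ge0 (y' i - y i)); lra.
have : \sum_i k * c i * (y' i - y i) >= 0.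
  rewrite -subr_le0 in sumy'1; rewrite -oppr_le0; apply: le_trans sumy'1.
  rewrite -[X in _ <= _ - X]sumy1 -sumrN -sumrB; apply: ler_sum => i _.
  by have := tangent i; lra.
under eq_bigr do rewrite -mulrA; rewrite -mulr_sumr pmulr_rge0//.
(* Complementary slackness [c i * (y i - x) = y i - x] turns the weighted sum of the [y i - x] into
   the unweighted one, which is 1. *)
have -> : \sum_i c i * (y' i - y i) =
    \sum_i c i * (y' i - x') - 1 + (\sum_i c i) * (x' - x).
  rewrite -sumyx mulr_suml -sumrB -big_split/=; apply: eq_bigr => i _.
  rewrite -cy; ring.
have : \sum_i c i * (y' i - x') <= 1.
  apply: le_trans sumy'x'; apply: ler_sum => i _.
  by rewrite ler_piMl ?subr_ge0//; have /andP[] := c01 i.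
have c0 : 0 < \sum_i c i.
  rewrite -[ltLHS](big1_eq _ _ : \sum_(i < d) 0 = 0).
  apply: ltr_sum; first exact: has_index.
  by move=> i _; have /andP[] := c01 i.
by rewrite -[x <= x']subr_ge0 -(pmulr_rge0 (x' - x) c0); lra.
Qed.

(* The minimizer is [y i = mu * max s (sqrt (lambda i))], [x = mu * s]: the first
   factor below is the [mu] making [\sum_i lambda i / y i = 1], and the equation
   for [s] then says that [\sum_i (y i - x) = 1]. *)
Lemma waterfilling_level : exists s : R, [/\ 0 <= s,
    forall i, 0 < Num.max s (Num.sqrt (lambda i))
  & (\sum_i lambda i / Num.max s (Num.sqrt (lambda i))) *
    (\sum_i (Num.max s (Num.sqrt (lambda i)) - s)) = 1].
Proof.
have pos s i : 0 < Num.max s (Num.sqrt (lambda i)).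
  by rewrite lt_max sqrtr_gt0 lambda_gt0 orbT.
pose h s := (\sum_i lambda i / Num.max s (Num.sqrt (lambda i))) *
    (\sum_i (Num.max s (Num.sqrt (lambda i)) - s)).
have maxC i (s : R) : {for s, continuous (fun s : R => Num.max s (Num.sqrt (lambda i)))}.
  apply: (@continuous_max R R id (fun=> Num.sqrt (lambda i))); first exact: cvg_id.
  exact: cvg_cst.
have hC s : {for s, continuous h}.
  apply: cvgM; (apply: cvg_big => [|i _]; first exact: add_continuous).
    by apply: cvgM; [exact: cvg_cst | apply: cvgV; [rewrite gt_eqF | exact: maxC]].
  by apply: cvgB; [exact: maxC | exact: cvg_id].
(* At 0 both factors are [\sum_i Num.sqrt (lambda i)], which is at least [\sum_i lambda i]; at 1 the
   second factor vanishes. *)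
have h0 : 1 <= h 0.
  rewrite /h.
  have max0 i : Num.max 0 (Num.sqrt (lambda i)) = Num.sqrt (lambda i).
    by apply/max_idPr; exact: sqrtr_ge0.
  have le_sqrt i : lambda i <= Num.sqrt (lambda i).
    rewrite -[leLHS]sqr_sqrtr ?(ltW (lambda_gt0 i))// expr2 ler_piMr ?sqrtr_ge0//.
    exact: sqrt_lambda_le1.
  rewrite -[leLHS]mulr1 ler_pM//.
    rewrite -[leLHS]lambda_sum; apply: ler_sum => i _; rewrite max0.
    rewrite ler_pdivlMr ?sqrtr_gt0// ler_piMr ?(ltW (lambda_gt0 i))//.
    exact: sqrt_lambda_le1.
  rewrite -[leLHS]lambda_sum; apply: ler_sum => i _; rewrite max0 subr0.
  exact: le_sqrt.
have h1 : h 1 = 0.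
  rewrite /h [X in _ * X]big1 ?mulr0// => i _; apply/eqP; rewrite subr_eq0.
  by apply/eqP/max_idPl; exact: sqrt_lambda_le1.
have [||s] := @IVT R h 0 1 1 ler01.
- by apply: continuous_in_subspaceT => s _; exact: hC.
- by rewrite h1 ge_min ler01 orbT le_max h0.
by rewrite in_itv/= => /andP[s0 _] hs; exists s.
Qed.

(** The solution meets both sum constraints with equality, while competitors need only the
    inequalities and [x'] may have any sign. Hence it serves both minimizations. *)
Lemma waterfilling : exists (x : R) (y : 'I_d -> R), [/\ 0 <= x,
    forall i, 0 < y i, forall i, x <= y i,
    \sum_i lambda i / y i = 1 /\ \sum_i (y i - x) = 1
  & forall (y' : 'I_d -> R) x', (forall i, 0 < y' i) -> (forall i, x' <= y' i) ->
    \sum_i lambda i / y' i <= 1 -> \sum_i (y' i - x') <= 1 -> x <= x'].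
Proof.
have [s [s0 pos hs]] := waterfilling_level.
pose m i := Num.max s (Num.sqrt (lambda i)).
pose mu := \sum_i lambda i / m i.
have mu0 : 0 < mu.
  rewrite -[ltLHS](big1_eq _ _ : \sum_(i < d) 0 = 0).
  apply: ltr_sum; first exact: has_index.
  by move=> i _; rewrite divr_gt0// pos.
have mun0 : mu != 0 by rewrite gt_eqF.
have sum1 : \sum_i lambda i / (mu * m i) = 1.
  rewrite -(divff mun0) [in RHS]/mu mulr_suml; apply: eq_bigr => i _.
  by rewrite invfM; ring.
have sum2 : \sum_i (mu * m i - mu * s) = 1.
  by rewrite -hs mulr_sumr; apply: eq_bigr => i _; rewrite mulrBr.
have ypos i : 0 < mu * m i by rewrite mulr_gt0// pos.
exists (mu * s), (fun i => mu * m i); split => //.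
- by rewrite mulr_ge0// ltW.
- by move=> i; rewrite ler_pM2l// le_max lexx.
move=> y' x' y'0 x'y' sumy'1 sumy'x'.
(* The weight [c i] is 1 where [m i = Num.sqrt (lambda i)], and elsewhere [m i = s] gives [y i = x];
   slackness holds in both cases. *)
apply: (@waterfilling_le (fun i => mu * m i) (fun i => lambda i / m i ^+ 2) y' (mu ^- 2)) => //.
- by rewrite invr_gt0 exprn_gt0.
- move=> i; rewrite divr_gt0 ?exprn_gt0 ?pos//= ler_pdivrMr ?exprn_gt0 ?pos//.
  rewrite mul1r -[leLHS]sqr_sqrtr ?(ltW (lambda_gt0 i))// ler_sqr ?nnegrE ?sqrtr_ge0 ?(ltW (pos i))//.
  by rewrite le_max lexx orbT.
- move=> i; rewrite exprMn; field.
  by rewrite mun0 gt_eqF// pos.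
- move=> i; rewrite /m; case: (leP s (Num.sqrt (lambda i))) => h; last by ring.
  by rewrite sqr_sqrtr ?(ltW (lambda_gt0 i))// divff ?mul1r ?gt_eqF ?lambda_gt0.
Qed.

Lemma secular_and_dual_minimum (d_gt0 : (0 < d)%N) : exists x : R,
  is_min (secular_maxima lambda) x /\ optimal_value lambda = (2 * x)%:E.
Proof.
have dn0 : d%:R != 0 :> R by rewrite pnatr_eq0 -lt0n.
have [x [y [x0 y0 xy [sumy1 sumyx] xmin]]] := waterfilling.
have sum_shift (z : 'I_d -> R) t : \sum_i (z i - t) = \sum_i z i - d%:R * t.
  by rewrite sumrB sumr_const card_ord -(mulr_natl t).
exists x; split; first split.
- exists (fun i => y i - x).
    by split => // i; rewrite subr_ge0.
  apply/maximumE/secular_roots_max; split => //.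
    by move=> i; rewrite subrKC.
  by under eq_bigr do rewrite subrKC.
- move=> _ [delta sdelta <-].
  have [z rz] := secular_roots_exists sdelta.
  rewrite (maximumE (secular_roots_max rz)).
  case: rz => z0 zpos zE; case: sdelta => delta0 delta1.
  (* A root [z] for [delta] is a feasible point of the convex program with [y' i - z = delta i]. *)
  apply: (xmin (fun i => z + delta i)) => //.
  + by move=> i; rewrite lerDl.
  + by rewrite zE.
  + by under eq_bigr do rewrite addrAC subrr add0r; rewrite delta1.
have inv_lam z i : 0 < z -> lambda i / (lambda i / z) = z.
  by move=> zi; field; rewrite !gt_eqF.
apply/le_anti/andP; split.
  (* Under [delta i = lambda i / y i], the equation [\sum_i (y i - x) = 1] makes the common lower
     bound in the constraints equal to [x] and the objective equal to [2 * x]. *)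
  apply: ereal_inf_lbound => /=; exists (fun i => lambda i / y i).
    split.
    + move=> i; rewrite inv_lam//.
      under eq_bigr do rewrite inv_lam//.
      rewrite sum_shift in sumyx.
      suff -> : d%:R^-1 * (\sum_j y j - 1) = x by [].
      have -> : \sum_j y j = 1 + d%:R * x by apply/eqP; rewrite -subr_eq; apply/eqP.
      by field.
    + by rewrite sumy1.
    + by move=> i; rewrite divr_gt0.
  rewrite /objective; under eq_bigr do rewrite inv_lam//.
  rewrite sum_shift in sumyx.
  have -> : \sum_j y j = 1 + d%:R * x by apply/eqP; rewrite -subr_eq; apply/eqP.
  by congr (_%:E); field.
apply: le_ereal_inf_tmp => _ [delta [cstr delta1 delta0] <-].
rewrite lee_fin /objective.
set t := \sum_i lambda i / delta i - 1.
have -> : 2 / d%:R * t = 2 * (d%:R^-1 * t) by rewrite mulrA.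
(* Here [x'] is [d%:R^-1 * t], chosen so that the shifted sum is exactly 1. *)
rewrite ler_pM2l//; apply: (xmin (fun i => lambda i / delta i)) => //.
- by move=> i; rewrite divr_gt0.
- by under eq_bigr do rewrite inv_lam//.
- rewrite sum_shift mulVKf// /t.
  lra.
Qed.

End SecularEquation.

Local Open Scope sesquilinear_scope.

(** * Similarity invariants *)

Section Similarity.
Variables (F : fieldType) (n : nat).
Implicit Types (P A : 'M[F]_n).

Lemma char_poly_conj P A : P \in unitmx ->
  char_poly (invmx P *m A *m P) = char_poly A.
Proof.
move=> Pu; rewrite /char_poly.
have PX : map_mx polyC P \in unitmx by rewrite map_unitmx.
suff -> : char_poly_mx (invmx P *m A *m P) =
    invmx (map_mx polyC P) *m char_poly_mx A *m map_mx polyC P.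
  by rewrite !det_mulmx mulrAC -det_mulmx mulVmx// det1 mul1r.
rewrite /char_poly_mx mulmxBr mulmxBl !map_mxM map_invmx.
by rewrite -!mulmxA -scalar_mxC mulKmx.
Qed.

Lemma char_poly_diag (a : 'rV[F]_n) :
  char_poly (diag_mx a) = \prod_(z <- [seq a 0 i | i : 'I_n]) ('X - z%:P).
Proof.
rewrite char_poly_trig ?diag_mx_is_trig// big_image/=.
by apply: eq_bigr => i _; rewrite mxE eqxx mulr1n.
Qed.

Lemma mxtrace_conj P A : P \in unitmx ->
  \tr (invmx P *m A *m P) = \tr A.
Proof. by move=> Pu; rewrite -mulmxA mxtrace_mulC -mulmxA mulmxV ?mulmx1. Qed.

End Similarity.

(** * The trace norm computed from an absolute value *)

Section TraceNorm.
Context {R : realType} {d : nat}.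
Implicit Types A P X : 'M[R[i]]_d.

(* The diagonalizations of [P] and of [P *m P] picked by [spectralmx] are
   unrelated; the characteristic polynomial matches their eigenvalues. *)
Lemma mxtrace_sqrtmx_sqr P : P^t* = P -> psdmx P ->
  \tr (sqrtmx (P *m P)) = \tr P.
Proof.
move=> Ph Ppsd.
have Pn : P \is normalmx by apply/normalmxP; rewrite Ph.
have PPn : P *m P \is normalmx.
  by apply/normalmxP; rewrite trmx_mul map_mxM Ph.
have /orthomx_spectralP PE := Pn.
set U := spectralmx P in PE; set a := spectral_diag P in PE.
have Uu : U \in unitmx by exact: spectral_unit.
(* Each eigenvalue is the quadratic form of [P] at the eigenvector [U^t* *m delta_mx i 0]. *)
have a0 i : 0 <= a 0 i.
  have := Ppsd (U^t* *m delta_mx i 0).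
  rewrite trmx_mul map_mxM trmxCK [in X in X -> _]PE.
  rewrite (invmx_unitary (spectral_unitarymx P)) -!mulmxA.
  rewrite [U *m (_ *m _)]mulmxA (unitarymxP (spectral_unitarymx P)) mul1mx.
  rewrite [U *m (_ *m _)]mulmxA (unitarymxP (spectral_unitarymx P)) mul1mx.
  rewrite trmx_delta map_delta_mx -rowE -colE !mxE eqxx.
  by rewrite mulr1n.
have PPE : P *m P = invmx U *m diag_mx (\row_i (a 0 i ^+ 2)) *m U.
  rewrite {1 2}PE -!mulmxA mulKVmx// [diag_mx _ *m (_ *m _)]mulmxA mulmx_diag.
  by congr (_ *m (diag_mx _ *m _)); apply/rowP => i; rewrite !mxE expr2.
have /orthomx_spectralP QE := PPn.
set V := spectralmx (P *m P) in QE; set b := spectral_diag (P *m P) in QE.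
have Vu : V \in unitmx by exact: spectral_unit.
(* Both lists are the roots, with multiplicity, of the characteristic polynomial of [P *m P]. *)
have ab : perm_eq [seq b 0 i | i : 'I_d] [seq (a 0 i) ^+ 2 | i : 'I_d].
  apply: prod_XsubC_eq; rewrite -char_poly_diag -(char_poly_conj _ Vu) -QE PPE.
  rewrite char_poly_conj// char_poly_diag.
  by congr (\prod_(z <- _) _); apply: eq_map => i; rewrite mxE.
rewrite /sqrtmx mxtrace_conj// [in RHS]PE mxtrace_conj// !mxtrace_diag.
under eq_bigr do rewrite mxE.
transitivity (\sum_(z <- [seq b 0 i | i : 'I_d]) sqrtC z); first by rewrite big_image.
rewrite (perm_big _ ab)/= big_image/=.
by apply: eq_bigr => i _; rewrite sqrCK.
Qed.

Lemma trnorm_absE X P : P^t* = P -> psdmx P -> X^t* *m X = P *m P ->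
  trnorm X = complex.Re (\tr P).
Proof. by move=> Ph Pp XP; rewrite /trnorm XP mxtrace_sqrtmx_sqr. Qed.

End TraceNorm.

(** * The trace norm of a projector minus a positive semidefinite matrix *)

Section Projector.
Context {R : realType} {d : nat}.
Implicit Types (A B D X : 'M[R[i]]_d) (v psi : 'cV[R[i]]_d).

Lemma psdmxD A B : psdmx A -> psdmx B -> psdmx (A + B).
Proof. by move=> pA pB v; rewrite mulmxDr mulmxDl mxE addr_ge0. Qed.

Lemma psdmxZ (k : R[i]) A : 0 <= k -> psdmx A -> psdmx (k *: A).
Proof. by move=> k0 pA v; rewrite -scalemxAr -scalemxAl mxE mulr_ge0. Qed.

Lemma psdmx_congr A B : psdmx A -> psdmx (B^t* *m A *m B).
Proof.
move=> pA v; have := pA (B *m v).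
by rewrite trmx_mul map_mxM !mulmxA.
Qed.

Lemma psdmx_projector v : psdmx (projector v).
Proof.
move=> u; rewrite /projector mulmxA -[_ *m _ *m u]mulmxA !mxE big_ord1.
have -> : (v^t* *m u) 0 0 = ((u^t* *m v) 0 0)^*.
  rewrite -[v in RHS]trmxCK -map_mxM -trmx_mul.
  by rewrite !mxE conjCK.
by rewrite -normCK exprn_ge0.
Qed.

Lemma projector_adj v : (projector v)^t* = projector v.
Proof. by rewrite /projector trmx_mul map_mxM trmxCK. Qed.

Lemma normsq_col v : (v^t* *m v) 0 0 = \sum_i `|v i 0| ^+ 2.
Proof. by rewrite mxE; apply: eq_bigr => i _; rewrite !mxE normCKC. Qed.

Lemma normsq_col_gt0 v : v != 0 -> 0 < (v^t* *m v) 0 0.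
Proof.
move=> v0; rewrite normsq_col lt_neqAle sumr_ge0 ?andbT; last first.
  by move=> i _; rewrite exprn_ge0.
apply: contra v0; rewrite eq_sym psumr_eq0 => [/allP n0|i _]; last by rewrite exprn_ge0.
apply/eqP/colP => i; rewrite mxE; apply/eqP.
by have := n0 i (mem_index_enum _); rewrite expf_eq0/= normr_eq0.
Qed.

Lemma trmxCB m n (M N : 'M[R[i]]_(m, n)) : (M - N)^t* = M^t* - N^t*.
Proof. by rewrite linearB map_mxB. Qed.

Lemma trmxCZ m n (k : R[i]) (M : 'M[R[i]]_(m, n)) : (k *: M)^t* = k^* *: M^t*.
Proof. by rewrite linearZ map_mxZ. Qed.

(** As [v] is an eigenvector of the Hermitian [X], the candidate [P] is [X] times the reflection
    [2 |v><v| / |v|^2 - 1], which commutes with [X] and squares to 1; hence [P *m P = X *m X]. *)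
Lemma trnorm_projector_sub psi D v (x : R) :
  D^t* = D -> psdmx D -> psi^t* *m v = 1%:M -> D *m v = psi - x%:C *: v ->
  0 <= x ->
  trnorm (projector psi - D) = complex.Re (2 * x%:C - \tr (projector psi - D)).
Proof.
move=> Dh Dpsd psiv Dv x0.
set X := projector psi - D.
have xC : (x%:C)^* = x%:C by apply/CrealP/ger0_real; rewrite ler0c.
have v0 : v != 0.
  apply: contra_eq_neq psiv => ->; rewrite mulmx0 eq_sym.
  by apply/eqP => /matrixP/(_ 0 0); rewrite !mxE eqxx => /eqP; rewrite oner_eq0.
set n := (v^t* *m v) 0 0.
have n0 : 0 < n by exact: normsq_col_gt0.
have nE : v^t* *m v = n%:M by rewrite [LHS]mx11_scalar.
have nn0 : n != 0 by rewrite gt_eqF.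
have vpsi : v^t* *m psi = 1%:M.
  by rewrite -[psi]trmxCK -map_mxM -trmx_mul psiv trmx1 map_mx1.
have vD : v^t* *m D = psi^t* - x%:C *: v^t*.
  by rewrite -[D in LHS]Dh -map_mxM -trmx_mul Dv trmxCB trmxCZ xC.
have Xv : X *m v = x%:C *: v.
  by rewrite mulmxBl -mulmxA psiv mulmx1 Dv subKr.
have Xh : X^t* = X by rewrite trmxCB Dh projector_adj.
have vX : v^t* *m X = x%:C *: v^t*.
  by rewrite -[X in LHS]Xh -map_mxM -trmx_mul Xv trmxCZ xC.
pose k := 2 * x%:C / n.
have k0 : 0 <= k by rewrite divr_ge0 ?(ltW n0)// mulr_ge0// ler0c.
pose P := k *: projector v - X.
have Ph : P^t* = P.
  by rewrite trmxCB Xh trmxCZ projector_adj (CrealP (ger0_real k0)).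
have trP : \tr P = 2 * x%:C - \tr X.
  rewrite linearB linearZ/= /projector mxtrace_mulC nE mxtrace_scalar mulr1n.
  by rewrite /k divfK.
rewrite -trP; apply: trnorm_absE => //.
  have -> : P = (1%:M - v *m psi^t*)^t* *m D *m (1%:M - v *m psi^t*) +
      (x%:C / n) *: (projector v + projector (v - n *: psi)).
    rewrite trmxCB trmx1 map_mx1 trmx_mul map_mxM trmxCK.
    rewrite mulmxBl mul1mx -mulmxA vD mulmxBr mulmx1.
    rewrite mulmxBl mulmxA Dv.
    have -> : psi *m (psi^t* - x%:C *: v^t*) *m (v *m psi^t*) =
        (1 - x%:C * n) *: (psi *m psi^t*).
      rewrite mulmxA -[psi *m _ *m v]mulmxA mulmxBl psiv -scalemxAl nE.
      by rewrite scale_scalar_mx -raddfB/= mul_mx_scalar -scalemxAl.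
    rewrite /P /X /projector trmxCB trmxCZ (CrealP (ger0_real (ltW n0))).
    rewrite !(mulmxBl, mulmxBr) -!scalemxAl -!scalemxAr.
    (* The identity is now linear in the outer products and [D], so it can be checked entrywise with
       the outer products arbitrary. *)
    move: (v *m v^t*) (v *m psi^t*) (psi *m v^t*) (psi *m psi^t*) => f e b a.
    by apply/matrixP => i j; rewrite !mxE /k; field.
  apply: psdmxD; first exact: psdmx_congr.
  apply: psdmxZ; first by rewrite divr_ge0 ?(ltW n0)// ler0c.
  by apply: psdmxD; exact: psdmx_projector.
have ff : projector v *m projector v = n *: projector v.
  by rewrite /projector mulmxA -[v *m _ *m v]mulmxA nE mul_mx_scalar scalemxAl.
have fX : projector v *m X = x%:C *: projector v.
  by rewrite /projector -mulmxA vX scalemxAr.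
have Xf : X *m projector v = x%:C *: projector v.
  by rewrite /projector mulmxA Xv scalemxAl.
rewrite Xh /P; move: (X) (projector v) ff fX Xf => Y f ff fY Yf.
rewrite [RHS]mulmxBl !mulmxBr -!scalemxAl -!scalemxAr ff fY Yf.
move: (Y *m Y) => YY.
by apply/matrixP => i j; rewrite !mxE /k; field.
Qed.


End Projector.

(** * Trace distances from the pure state to incoherent states *)

Section CoherenceOfPureState.
Context {R : realType} {d : nat}.
Variable lambda : 'I_d -> R.
Hypothesis lambda_gt0 : forall i, 0 < lambda i.
Hypothesis lambda_sum : \sum_i lambda i = 1.
Implicit Types delta : 'I_d -> R.

Definition diagc delta : 'M[R[i]]_d := diag_mx (\row_i (delta i)%:C).

Lemma conjC_real (x : R) : (x%:C)^* = x%:C.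
Proof. exact: conjc_real. Qed.

Lemma diagc_adj delta : (diagc delta)^t* = diagc delta.
Proof.
apply/matrixP => i j; rewrite !mxE [j == i]eq_sym.
by case: eqP => [->|_]; rewrite ?mulr1n ?mulr0n ?conjC_real ?rmorph0.
Qed.

Lemma psdmx_diagc delta : (forall i, 0 <= delta i) -> psdmx (diagc delta).
Proof.
move=> delta0 v; rewrite mul_mx_diag mxE sumr_ge0// => i _.
rewrite !mxE mulrAC -normCKC mulr_ge0 ?exprn_ge0//.
by rewrite ler0c.
Qed.

Lemma mxtrace_diagc delta : \tr (diagc delta) = (\sum_i delta i)%:C.
Proof.
by rewrite mxtrace_diag rmorph_sum/=; apply: eq_bigr => i _; rewrite mxE.
Qed.

(** Testing positivity on basis vectors shows that the diagonal entries are nonnegative reals, so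
    taking real parts loses nothing. *)
Lemma incoherentE : incoherent = [set diagc delta | delta in simplex].
Proof.
apply/seteqP; split=> [A [[Apsd trA] /is_diag_mxP Adiag]|_ [delta [delta0 delta1] <-]].
  have A0 i : 0 <= A i i.
    have := Apsd (delta_mx i 0).
    by rewrite trmx_delta map_delta_mx -rowE -colE !mxE.
  pose delta i := complex.Re (A i i).
  have deltaE i : (delta i)%:C = A i i by rewrite RRe_real// ger0_real.
  exists delta; first split.
  - by move=> i; rewrite -ler0c deltaE.
  - apply: (@complexI R); rewrite rmorph_sum/= -[RHS]trA.
    by apply: eq_bigr => i _; rewrite deltaE.
  apply/matrixP => i j; rewrite !mxE; case: eqVneq => [->|ij].
    by rewrite mulr1n deltaE.
  by rewrite mulr0n Adiag.
split; last exact: diag_mx_is_diag.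
by split; [exact: psdmx_diagc | rewrite mxtrace_diagc delta1].
Qed.

Lemma sqrt_ket_norm : (sqrt_ket lambda)^t* *m sqrt_ket lambda = 1%:M.
Proof.
rewrite [LHS]mx11_scalar; congr (_%:M).
rewrite mxE -[RHS]/(1%:C) -lambda_sum rmorph_sum; apply: eq_bigr => i _.
rewrite !mxE conjC_real -rmorphM/= -expr2 sqr_sqrtr//; exact: ltW.
Qed.

(** The secular equation is exactly the normalization [<psi, v> = 1], and the trace term drops out
    because both matrices have trace 1. *)
Lemma trnorm_secular delta x : simplex delta ->
  secular_roots lambda delta x ->
  trnorm (projector (sqrt_ket lambda) - diagc delta) = 2 * x.
Proof.
move=> [delta0 delta1] [x0 xpos xE].
pose v : 'cV[R[i]]_d := \col_i (Num.sqrt (lambda i) / (x + delta i))%:C.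
rewrite (@trnorm_projector_sub _ _ _ _ v x)//.
- have -> : \tr (projector (sqrt_ket lambda) - diagc delta) = 0.
    rewrite raddfB/= mxtrace_diagc delta1 /projector mxtrace_mulC sqrt_ket_norm.
    by rewrite mxtrace_scalar mulr1n subrr.
  by rewrite subr0 -(rmorph_nat (real_complex R)) -rmorphM/=.
- exact: diagc_adj.
- exact: psdmx_diagc.
- rewrite [LHS]mx11_scalar; congr (_%:M).
  rewrite mxE -[RHS]/(1%:C) -xE rmorph_sum; apply: eq_bigr => i _.
  by rewrite !mxE conjC_real -rmorphM/= mulrA -expr2 sqr_sqrtr// ltW.
- rewrite mul_diag_mx; apply/colP => i; rewrite !mxE -!rmorphM -rmorphB.
  by congr (_%:C); field; rewrite gt_eqF.
Qed.

Lemma trdists_projector : trdists (projector (sqrt_ket lambda)) =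
  [set 2 * x | x in secular_maxima lambda].
Proof.
rewrite /trdists incoherentE; apply/seteqP; split.
  move=> _ [_ [delta sdelta <-] <-].
  have [x rx] := secular_roots_exists lambda_gt0 lambda_sum sdelta.
  exists x; last by rewrite (trnorm_secular sdelta rx).
  exists delta => //; apply: maximumE.
  exact: (secular_roots_max lambda_gt0 lambda_sum rx).
move=> _ [_ [delta sdelta <-] <-].
have [x rx] := secular_roots_exists lambda_gt0 lambda_sum sdelta.
exists (diagc delta); first by exists delta.
rewrite (maximumE (secular_roots_max lambda_gt0 lambda_sum rx)).
exact: trnorm_secular.
Qed.

End CoherenceOfPureState.

(* The first three conclusions say that every "min" and "max" occurring in the
   last two is attained. *)
Theorem mainTheorem3 (R : realType) (d : nat) (lambda : 'I_d -> R)
    (d_ge1 : (1 <= d)%N)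
    (lambda_gt0 : forall i, 0 < lambda i)
    (lambda_sum : \sum_i lambda i = 1) :
  [/\ has_min (trdists (projector (sqrt_ket lambda))),
      forall delta : 'I_d -> R, simplex delta ->
        has_max (secular_roots lambda delta),
      has_min (secular_maxima lambda),
      Ctr (projector (sqrt_ket lambda)) = 2 * minimum (secular_maxima lambda)
    & (Ctr (projector (sqrt_ket lambda)))%:E = optimal_value lambda].
Proof.
have [x [xmin optE]] := secular_and_dual_minimum lambda_gt0 lambda_sum d_ge1.
have dmin : is_min (trdists (projector (sqrt_ket lambda))) (2 * x).
  by rewrite trdists_projector//; exact: is_min_scale.
split.
- by exists (2 * x).
- move=> delta sdelta.
  have [y ry] := secular_roots_exists lambda_gt0 lambda_sum sdelta.
  by exists y; exact: secular_roots_max.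
- by exists x.
- by rewrite /Ctr (minimumE dmin) (minimumE xmin).
- by rewrite /Ctr (minimumE dmin) optE.
Qed.
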